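(* Let $d\ge2$ and let $Q$ be a Hilbert qplex. Then the preservation group $\mathcal{G}(Q)$ is isomorphic to the projective extended unitary group $\mathrm{PEU}(d)$.
   Context: Fix an integer $d\ge 2$. $\langle\cdot,\cdot\rangle$ is the standard inner product on $\mathbb{R}^{d^2}$, $\|\cdot\|$ the Euclidean norm. $\Delta=\{p\in\mathbb{R}^{d^2}: p(i)\ge0,\ \sum_ip(i)=1\}$; $H=\{u\in\mathbb{R}^{d^2}:\sum_i u(i)=1\}$; $c=(1/d^2,\dots,1/d^2)$. For $A\subseteq H$ the polar is $A^*=\{u\in H:\langle u,v\rangle\ge\frac{1}{d(d+1)}\ \forall v\in A\}$. Out-ball $B_{\rm o}=\{u\in H:\|u-c\|\le r_{\rm o}\}$, $r_{\rm o}^2=\frac{d-1}{d^2(d+1)}$. A qplex is a set $Q\subseteq\Delta\cap B_{\rm o}$ with $Q^*=Q$. A measurement is an array $r(i|j)\ge0$ with $\sum_i r(i|j)=1$ for every $j$; for $q\in Q$, $q_r(i)=\sum_j[(d+1)q(j)-\frac1d]r(i|j)$; it is $Q$-preserving if $\{q_r:q\in Q\}=Q$; its stretched measurement matrix is $R_{ij}=(d+1)r(i|j)-\frac1d\sum_k r(i|k)$. The preservation group $\mathcal{G}(Q)$ is the set of stretched measurement matrices of $Q$-preserving measurements. Let $B_H$ be the real vector space of Hermitian operators on $\mathbb{C}^d$ and $S$ the set of density matrices. A qplex $Q$ is a Hilbert qplex if there is an $\mathbb{R}$-linear bijection $f:B_H\to\mathbb{R}^{d^2}$ with $f(S)=Q$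 and $\langle f(\rho),f(\rho')\rangle=\frac{\mathrm{Tr}(\rho\rho')+1}{d(d+1)}$ for all $\rho,\rho'\in S$. $\mathrm{EU}(d)$ is the group of all unitary and anti-unitary operators on $\mathbb{C}^d$, and $\mathrm{PEU}(d)=\mathrm{EU}(d)/\{e^{i\theta}I\}$. *)

(* Defs.v *)
(* The field of complex numbers is an arbitrary
   numClosedFieldType C (the library's setting for complex linear algebra,
   cf. spectral.v); "real numbers" are the elements x of C with
   x \is Num.real. *)
From HB Require Import structures.
From mathcomp Require Import all_boot all_order all_algebra.
Set Implicit Arguments. Unset Strict Implicit. Unset Printing Implicit Defensive.
Import Order.TTheory GRing.Theory Num.Theory.
Local Open Scope ring_scope.

Section Qplex.
Variables (C : numClosedFieldType) (d : nat).

(* vectors of R^{d^2} are real column vectors of length d^2 *)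
Definition vec := 'cV[C]_(d ^ 2).

Definition realv (u : vec) : Prop := forall i, u i 0 \is Num.real.

Definition dotv (u v : vec) : C := \sum_i u i 0 * v i 0.

Definition inDelta (p : vec) : Prop :=
  (forall i, 0 <= p i 0) /\ \sum_i p i 0 = 1.

Definition inH (u : vec) : Prop := realv u /\ \sum_i u i 0 = 1.

Definition cvec : vec := const_mx (((d ^ 2)%N)%:R)^-1.

Definition kappa : C := (((d * (d + 1))%N)%:R)^-1.

(* polar of a set A (A is a subset of H) *)
Definition polar (A : vec -> Prop) : vec -> Prop :=
  fun u => inH u /\ forall v, A v -> kappa <= dotv u v.

Definition ro2 : C := ((d - 1)%N)%:R / (((d ^ 2 * (d + 1))%N)%:R).
Definition inBo (u : vec) : Prop :=
  inH u /\ dotv (u - cvec) (u - cvec) <= ro2.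

Definition qplex (Q : vec -> Prop) : Prop :=
  (forall q, Q q -> inDelta q /\ inBo q) /\ (forall u, polar Q u <-> Q u).

(* measurements r(i|j) = r i j *)
Definition measurement (r : 'M[C]_(d ^ 2)) : Prop :=
  (forall i j, 0 <= r i j) /\ (forall j, \sum_i r i j = 1).

Definition qr (r : 'M[C]_(d ^ 2)) (q : vec) : vec :=
  \col_i \sum_j ((d + 1)%:R * q j 0 - (d%:R)^-1) * r i j.

Definition Qpreserving (Q : vec -> Prop) (r : 'M[C]_(d ^ 2)) : Prop :=
  forall u, Q u <-> exists q, Q q /\ u = qr r q.

Definition stretched (r : 'M[C]_(d ^ 2)) : 'M[C]_(d ^ 2) :=
  \matrix_(i, j) ((d + 1)%:R * r i j - (d%:R)^-1 * \sum_k r i k).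

(* the preservation group G(Q), as a set of matrices (group law: matrix product) *)
Definition inG (Q : vec -> Prop) (M : 'M[C]_(d ^ 2)) : Prop :=
  exists r, [/\ measurement r, Qpreserving Q r & M = stretched r].

Definition hermitian (A : 'M[C]_d) : Prop := forall i j, A j i = (A i j)^*.

Definition ipC (x y : 'cV[C]_d) : C := \sum_i (x i 0)^* * y i 0.

Definition density (A : 'M[C]_d) : Prop :=
  [/\ hermitian A, forall x : 'cV[C]_d, 0 <= ipC x (A *m x) & \tr A = 1].

Definition hilbert_qplex (Q : vec -> Prop) : Prop :=
  qplex Q /\
  exists f : 'M[C]_d -> vec,
    [/\
        (forall A, hermitian A -> realv (f A)) /\
        (forall (a b : C) A B, a \is Num.real -> b \is Num.real ->
           hermitian A -> hermitian B -> f (a *: A + b *: B) = a *: f A + b *: f B),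
        (forall A B, hermitian A -> hermitian B -> f A = f B -> A = B),
        (forall u, realv u -> exists A, hermitian A /\ f A = u),
        (forall u, Q u <-> exists rho, density rho /\ u = f rho) &
        (forall rho rho', density rho -> density rho' ->
           dotv (f rho) (f rho') = (\tr (rho *m rho') + 1) / ((d * (d + 1))%N)%:R)].

Definition unitary_op (U : 'cV[C]_d -> 'cV[C]_d) : Prop :=
  [/\ forall x y, U (x + y) = U x + U y,
      forall (a : C) x, U (a *: x) = a *: U x,
      forall x y, ipC (U x) (U y) = ipC x y &
      forall y, exists x, U x = y].

Definition antiunitary_op (U : 'cV[C]_d -> 'cV[C]_d) : Prop :=
  [/\ forall x y, U (x + y) = U x + U y,
      forall (a : C) x, U (a *: x) = a^* *: U x,
      forall x y, ipC (U x) (U y) = (ipC x y)^* &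
      forall y, exists x, U x = y].

Definition EU (U : 'cV[C]_d -> 'cV[C]_d) : Prop := unitary_op U \/ antiunitary_op U.

(* U and V define the same element of PEU(d) = EU(d)/{e^{i theta} I} *)
Definition phase_equiv (U V : 'cV[C]_d -> 'cV[C]_d) : Prop :=
  exists z : C, `|z| = 1 /\ forall x, U x = z *: V x.

End Qplex.

(* Main.v *)
(* A Hilbert qplex is the image of the density matrices under [A |-> (tr (A E_i))_i],
   where [E] is a SIC measurement with dual basis [G = d(d+1) E - 1]; on the
   hyperplane H the map [q |-> q_r] is multiplication by the stretched matrix. An
   (anti)unitary [U] acts on Hermitian matrices by [A |-> U A U^-1], and its matrix
   in the basis [G] lies in G(Q) because [tr (U E_j U^-1 E_i) >= 0].
   Conversely a stretched matrix [M] in G(Q) gives a trace-preserving linear map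
   carrying the density matrices onto themselves; its trace-adjoint [S] is a unital
   order isomorphism. As projections are the extreme points of the order interval
   [0, 1], [S] preserves them, hence by the spectral theorem preserves squares
   (Kadison). Evaluating such a Jordan *-automorphism on the matrix units shows
   that it is [A |-> u A u^*] or [A |-> u A^T u^*] with [u] unitary. *)
From HB Require Import structures.
From mathcomp Require Import all_boot all_order all_algebra.
From mathcomp Require Import ring.
Require Import Defs.
Set Implicit Arguments. Unset Strict Implicit. Unset Printing Implicit Defensive.
Import Order.TTheory GRing.Theory Num.Theory.
Local Open Scope ring_scope.
Local Open Scope sesquilinear_scope.

(** * Positive semidefinite matrices *)

Section Adjoint.
Variable C : numClosedFieldType.

Lemma trCE m n (A : 'M[C]_(m, n)) i j : A^t* i j = (A j i)^*.
Proof. by rewrite !mxE. Qed.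

Lemma trC_add m n (A B : 'M[C]_(m, n)) : (A + B)^t* = A^t* + B^t*.
Proof. by rewrite linearD map_mxD. Qed.

Lemma trC_opp m n (A : 'M[C]_(m, n)) : (- A)^t* = - A^t*.
Proof. by rewrite linearN map_mxN. Qed.

Lemma trC_sub m n (A B : 'M[C]_(m, n)) : (A - B)^t* = A^t* - B^t*.
Proof. by rewrite trC_add trC_opp. Qed.

Lemma trC_scale m n (a : C) (A : 'M[C]_(m, n)) : (a *: A)^t* = a^* *: A^t*.
Proof. by rewrite linearZ map_mxZ. Qed.

Lemma trC_mul m n p (A : 'M[C]_(m, n)) (B : 'M[C]_(n, p)) :
  (A *m B)^t* = B^t* *m A^t*.
Proof. by rewrite trmx_mul map_mxM. Qed.

Lemma trC_1 n : (1%:M : 'M[C]_n)^t* = 1%:M.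
Proof. by rewrite trmx1 map_mx1. Qed.

Lemma trC_delta m n (i : 'I_m) (j : 'I_n) :
  (delta_mx i j : 'M[C]_(m, n))^t* = delta_mx j i.
Proof. by rewrite trmx_delta map_delta_mx. Qed.

Lemma trC_sum m n I (r : seq I) (P : pred I) (F : I -> 'M[C]_(m, n)) :
  (\sum_(i <- r | P i) F i)^t* = \sum_(i <- r | P i) (F i)^t*.
Proof.
apply: (big_morph (fun A : 'M[C]_(m, n) => A^t*)); first exact: trC_add.
by rewrite trmx0 map_mx0.
Qed.

Lemma tr_trC n (A : 'M[C]_n) : \tr (A^t*) = (\tr A)^*.
Proof. by rewrite /mxtrace rmorph_sum; apply: eq_bigr => i _; rewrite trCE. Qed.

Lemma tr_mul_real n (A B : 'M[C]_n) :
  A^t* = A -> B^t* = B -> \tr (A *m B) \is Num.real.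
Proof. by move=> hA hB; rewrite CrealE -tr_trC trC_mul hA hB mxtrace_mulC. Qed.

End Adjoint.

Section Psd.
Variables (C : numClosedFieldType) (d : nat).
Implicit Types (A B P : 'M[C]_d) (x y : 'cV[C]_d).

Lemma hermitianP A : hermitian A <-> A^t* = A.
Proof.
split=> hA; first by apply/matrixP=> i j; rewrite trCE -hA.
by move=> i j; rewrite -trCE hA.
Qed.

Lemma ipCE x y : ipC x y = (x^t* *m y) 0 0.
Proof. by rewrite mxE; apply: eq_bigr => i _; rewrite trCE. Qed.

Lemma mulmx_ipC x y : x^t* *m y = (ipC x y)%:M.
Proof. by rewrite [LHS]mx11_scalar ipCE. Qed.

Lemma mxtrace_outer x y : \tr (x *m y^t*) = ipC y x.
Proof. by rewrite mxtrace_mulC mulmx_ipC mxtrace_scalar. Qed.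

Lemma ipCDr x y1 y2 : ipC x (y1 + y2) = ipC x y1 + ipC x y2.
Proof. by rewrite !ipCE mulmxDr mxE. Qed.

Lemma ipCDl x1 x2 y : ipC (x1 + x2) y = ipC x1 y + ipC x2 y.
Proof. by rewrite !ipCE trC_add mulmxDl mxE. Qed.

Lemma ipCZr a x y : ipC x (a *: y) = a * ipC x y.
Proof. by rewrite !ipCE -scalemxAr mxE. Qed.

Lemma ipCZl a x y : ipC (a *: x) y = a^* * ipC x y.
Proof. by rewrite !ipCE trC_scale -scalemxAl mxE. Qed.

Lemma ipCC x y : (ipC x y)^* = ipC y x.
Proof. by rewrite !ipCE -trCE trC_mul trmxCK. Qed.

Lemma ipC_adj A x y : ipC x (A *m y) = ipC (A^t* *m x) y.
Proof. by rewrite !ipCE trC_mul trmxCK mulmxA. Qed.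

Lemma ipC_ge0 x : 0 <= ipC x x.
Proof. by apply: sumr_ge0 => i _; rewrite mulrC mul_conjC_ge0. Qed.

Lemma ipC_eq0 x : ipC x x = 0 -> x = 0.
Proof.
move=> h; apply/matrixP=> i j; rewrite ord1 mxE; apply/eqP.
rewrite -mul_conjC_eq0; apply/eqP; rewrite mulrC; move: i {j} (erefl true).
apply: (psumr_eq0P _ h) => i _; by rewrite mulrC mul_conjC_ge0.
Qed.

Lemma ipC_inj x y : (forall z, ipC z x = ipC z y) -> x = y.
Proof.
move=> h; apply/eqP; rewrite -subr_eq0; apply/eqP/ipC_eq0.
by rewrite ipCDr -scaleN1r ipCZr h mulN1r subrr.
Qed.

Lemma ipC_delta (i : 'I_d) x : ipC (delta_mx i 0) x = x i 0.
Proof. by rewrite ipCE trC_delta -rowE mxE. Qed.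

Lemma delta_decomp x : x = \sum_i x i 0 *: delta_mx i 0.
Proof. by rewrite {1}[x]matrix_sum_delta; apply: eq_bigr => i _; rewrite big_ord1. Qed.

Definition psd A : Prop := A^t* = A /\ forall x, 0 <= ipC x (A *m x).

Lemma densityP A : density A <-> psd A /\ \tr A = 1.
Proof.
split=> [[/hermitianP h1 h2 h3]|[[/hermitianP h1 h2] h3]] //.
Qed.

Lemma psd_conj A B : psd A -> psd (B^t* *m A *m B).
Proof.
move=> [hA pA]; split; first by rewrite !trC_mul trmxCK hA mulmxA.
by move=> x; rewrite -!mulmxA ipC_adj trmxCK.
Qed.

Lemma psdD A B : psd A -> psd B -> psd (A + B).
Proof.
move=> [hA pA] [hB pB]; split; first by rewrite trC_add hA hB.
by move=> x; rewrite mulmxDl ipCDr addr_ge0.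
Qed.

Lemma psdZ a A : 0 <= a -> psd A -> psd (a *: A).
Proof.
move=> a0 [hA pA]; split; first by rewrite trC_scale hA geC0_conj.
by move=> x; rewrite -scalemxAl ipCZr mulr_ge0.
Qed.

Lemma psd1 : psd 1%:M.
Proof. by split; [rewrite trC_1 | move=> x; rewrite mul1mx ipC_ge0]. Qed.

Lemma psd_sqr A : A^t* = A -> psd (A *m A).
Proof. by move=> hA; have := psd_conj A psd1; rewrite mulmx1 hA. Qed.

Lemma psd_outer x : psd (x *m x^t*).
Proof.
split; first by rewrite trC_mul trmxCK.
move=> y; rewrite -mulmxA mulmx_ipC mul_mx_scalar ipCZr -ipCC mulrC.
exact: mul_conjC_ge0.
Qed.

(** A nonnegative form attains its minimum at an isotropic vector, so moving from [x] in the
    direction [- A *m x] must not make it negative. *)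
Lemma psd_ker A x : psd A -> ipC x (A *m x) = 0 -> A *m x = 0.
Proof.
move=> [hA pA] h0; set y := A *m x; set n := ipC y y; set c := ipC y (A *m y).
have n0 : 0 <= n by apply: ipC_ge0.
have c0 : 0 <= c by apply: pA.
have nr : n^* = n by apply: geC0_conj.
have cr : c^* = c by apply: geC0_conj.
have c1 : 0 < c + 1 by rewrite ltr_wpDl.
apply: ipC_eq0; rewrite -/n.
(* The step length n/(c+1) keeps a positive denominator even when c = 0. The form takes the value
   -n^2(c+2)/(c+1)^2 there, which forces n = 0. *)
have := pA (x - (n / (c + 1)) *: y).
rewrite mulmxBr -scalemxAr -/y.
have hxy : ipC x (A *m y) = n by rewrite ipC_adj hA.
rewrite -!scaleNr !(ipCDl, ipCDr) !ipCZr !ipCZl h0 hxy -/n -/c.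
have -> : (- (n / (c + 1)))^* = - (n / (c + 1)).
  by rewrite rmorphN rmorphM fmorphV rmorphD rmorph1 /= nr cr.
have -> : 0 + - (n / (c + 1)) * n +
      (- (n / (c + 1)) * n + - (n / (c + 1)) * (- (n / (c + 1)) * c)) = - (n ^+ 2 * (c + 2) / (c + 1) ^+ 2) by field; rewrite gt_eqF.
rewrite oppr_ge0 pmulr_lle0 ?invr_gt0 ?exprn_gt0 // pmulr_lle0 ?ltr_wpDl //.
by move=> h; apply/eqP; rewrite -(sqrf_eq0 n) eq_le h exprn_ge0.
Qed.

(** The form of [A] vanishes at every basis vector, so [psd_ker] kills every column. *)
Lemma psd_antisym A : psd A -> psd (- A) -> A = 0.
Proof.
move=> pA [_ nA]; apply/matrixP=> i j.
have : A *m delta_mx j (0 : 'I_1) = 0.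
  apply: psd_ker => //; apply/eqP; rewrite eq_le pA.2 andbT.
  by have := nA (delta_mx j 0); rewrite mulNmx -scaleN1r ipCZr mulN1r oppr_ge0.
by rewrite -colE => /matrixP/(_ i 0); rewrite !mxE.
Qed.

(** Restates the unitary diagonalisation A = W^* D W through rank-one projections onto the columns
    of W^*. *)
Lemma herm_spectral A : A^t* = A ->
  exists (l : 'I_d -> C) (v : 'I_d -> 'cV[C]_d),
    [/\ forall i, l i \is Num.real,
        forall i j, ipC (v i) (v j) = (i == j)%:R,
        forall i, A *m v i = l i *: v i &
        A = \sum_i l i *: (v i *m (v i)^t*)].
Proof.
move=> hA; have hs : A \is hermsymmx by apply/is_hermitianmxP; rewrite expr0 scale1r.
have /orthomx_spectralP := hermitian_normalmx hs.
have /mxOverP lr := hermitian_spectral_diag_real hs.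
have uS := spectral_unitarymx A.
rewrite (invmx_unitary uS); move: (spectralmx A) (spectral_diag A) uS lr => W D uW lr eA.
have WWt : W *m W^t* = 1%:M by apply/unitarymxP.
have hv i : (col i (W^t*))^t* = row i W by apply/matrixP=> k l; rewrite !mxE conjCK.
have oW i j : ipC (col i (W^t*)) (col j (W^t*)) = (i == j)%:R.
  have /matrixP/(_ i j) := WWt; rewrite !mxE => <-.
  by apply: eq_bigr => k _; rewrite !mxE conjCK.
have sA : A = \sum_i D 0 i *: (col i (W^t*) *m (col i (W^t*))^t*).
  rewrite {1}eA; apply/matrixP=> k l; rewrite mxE summxE; apply: eq_bigr => i _.
  by rewrite hv mul_mx_diag !mxE big_ord1 !mxE mulrA [D 0 i * _]mulrC.
exists (fun i => D 0 i), (fun i => col i (W^t*)); split=> // i.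
rewrite {1}sA mulmx_suml (bigD1 i) //= big1 ?addr0 => [|j ji];
  rewrite -scalemxAl -mulmxA mulmx_ipC oW ?eqxx ?mulmx1 //.
by rewrite (negbTE ji) -scalemx1 scale0r mulmx0 scaler0.
Qed.

Lemma psd_spectral A : psd A -> 
  exists (l : 'I_d -> C) (v : 'I_d -> 'cV[C]_d),
    [/\ forall i, 0 <= l i & A = \sum_i l i *: (v i *m (v i)^t*)].
Proof.
move=> [hA pA]; have [l [v [_ ov ev eA]]] := herm_spectral hA.
exists l, v; split=> // i.
by have := pA (v i); rewrite ev ipCZr ov eqxx mulr1.
Qed.

Lemma tr_outer_mul x A : \tr (x *m x^t* *m A) = ipC x (A *m x).
Proof. by rewrite -mulmxA mxtrace_mulC -mulmxA mulmx_ipC mxtrace_scalar. Qed.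

Lemma psd_tr_ge0 A B : psd A -> psd B -> 0 <= \tr (A *m B).
Proof.
move=> /psd_spectral[l [v [l0 ->]]] [_ pB].
rewrite mulmx_suml linear_sum; apply: sumr_ge0 => i _.
by rewrite -scalemxAl linearZ /= tr_outer_mul mulr_ge0.
Qed.

Lemma density_outer x : ipC x x = 1 -> density (x *m x^t*).
Proof. by move=> hx; apply/densityP; split; [exact: psd_outer|rewrite mxtrace_outer]. Qed.

(** Self-duality of the positive cone: normalised rank-one matrices are enough as test densities. *)
Lemma psd_dual A : A^t* = A -> (forall rho, density rho -> 0 <= \tr (rho *m A)) -> psd A.
Proof.
move=> hA h; split=> // x.
have [->|x0] := eqVneq x 0; first by rewrite mulmx0 ipCE mulmx0 mxE.
have n0 : 0 < ipC x x.
  by rewrite lt_def ipC_ge0 andbT; apply: contraNneq x0 => /ipC_eq0 ->.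
have : density ((ipC x x)^-1 *: (x *m x^t*)).
  apply/densityP; split.
    by apply: psdZ; rewrite ?invr_ge0 ?ltW //; apply: psd_outer.
  by rewrite linearZ /= mxtrace_outer mulVf // gt_eqF.
by move/h; rewrite -scalemxAl linearZ /= tr_outer_mul pmulr_rge0 // invr_gt0.
Qed.

Lemma tr_inj A B : (forall X, \tr (X *m A) = \tr (X *m B)) -> A = B.
Proof.
move=> h; apply/matrixP=> i j; have := h (delta_mx j i).
have E (Y : 'M[C]_d) : \tr (delta_mx j i *m Y) = Y i j.
  rewrite -(mul_delta_mx (0 : 'I_1)) -mulmxA -rowE.
  rewrite mxtrace_mulC -colE.
  by rewrite /mxtrace big_ord1 !mxE.
by rewrite !E.
Qed.

(** Serves to extend facts from Hermitian matrices to all matrices by complex linearity. *)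
Lemma cartesian_decomp A :
  exists H K, [/\ H^t* = H, K^t* = K & A = H + 'i *: K].
Proof.
exists (2^-1 *: (A + A^t*)), ((2 * 'i)^-1 *: (A - A^t*)).
have r2 : (2^-1 : C)^* = 2^-1 by rewrite fmorphV rmorph_nat.
have i2 : ((2 * 'i)^-1 : C)^* = - (2 * 'i)^-1.
  by rewrite fmorphV rmorphM rmorph_nat /= conjCi mulrN invrN.
split; first by rewrite trC_scale trC_add trmxCK addrC r2.
  by rewrite trC_scale trC_sub trmxCK i2 scaleNr -scalerN opprB.
rewrite scalerA invfM mulrCA mulfV ?neq0Ci // mulr1 -scalerDr addrACA subrr addr0.
by rewrite -mulr2n -scaler_nat scalerA mulVf ?pnatr_eq0 // scale1r.
Qed.

End Psd.

(** * Unitary and antiunitary conjugation *)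

Section ExtendedUnitary.
Variables (C : numClosedFieldType) (d : nat).
Implicit Types (A B P : 'M[C]_d) (x y : 'cV[C]_d) (U V W : 'cV[C]_d -> 'cV[C]_d).

(** The flag [s] is [true] in the antilinear case, so that unitary and antiunitary operators share
    all proofs. *)
Definition conj_if (s : bool) (a : C) : C := if s then a^* else a.

Lemma conj_ifK s : involutive (conj_if s).
Proof. by case: s => a //=; rewrite conjCK. Qed.

Lemma conj_if_real s a : a \is Num.real -> conj_if s a = a.
Proof. by case: s => //= ra; apply: conj_Creal. Qed.

Lemma conj_if_sum s I (r : seq I) (P : pred I) (F : I -> C) :
  conj_if s (\sum_(i <- r | P i) F i) = \sum_(i <- r | P i) conj_if s (F i).
Proof. by case: s => //=; rewrite rmorph_sum. Qed.

Lemma norm_conj_if s a : `|conj_if s a| = `|a|.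
Proof. by case: s => //=; rewrite norm_conjC. Qed.

Definition eu (s : bool) U : Prop :=
  [/\ forall x y, U (x + y) = U x + U y,
      forall (a : C) x, U (a *: x) = conj_if s a *: U x,
      forall x y, ipC (U x) (U y) = conj_if s (ipC x y) &
      forall y, exists x, U x = y].

Lemma EUP U : EU U <-> exists s, eu s U.
Proof.
split; first by case=> h; [exists false|exists true].
by case=> -[] h; [right|left].
Qed.

Lemma eu_sum s U I (r : seq I) (P : pred I) (F : I -> 'cV[C]_d) : eu s U ->
  U (\sum_(i <- r | P i) F i) = \sum_(i <- r | P i) U (F i).
Proof.
move=> [UD UZ _ _]; apply: (big_morph U UD).
by rewrite -(scale0r 0) UZ conj_if_real ?scale0r // real0.
Qed.

Lemma eu_inj s U : eu s U -> injective U.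
Proof.
move=> [UD UZ Uip _] x y e; apply: ipC_inj => z.
by rewrite -[LHS](conj_ifK s) -[RHS](conj_ifK s) -!Uip e.
Qed.

Lemma eu_comp s t U V : eu s U -> eu t V -> eu (s (+) t) (fun x => U (V x)).
Proof.
move=> [UD UZ Uip Us] [VD VZ Vip Vs].
have cc a : conj_if s (conj_if t a) = conj_if (s (+) t) a.
  by case: s t {UZ Uip VZ Vip} => -[] //=; rewrite conjCK.
split=> [x y|a x|x y|y].
- by rewrite VD UD.
- by rewrite VZ UZ cc.
- by rewrite Uip Vip cc.
- by have [z <-] := Us y; have [x <-] := Vs z; exists x.
Qed.

Lemma eu_inv s U : eu s U -> exists V, [/\ eu s V, cancel U V & cancel V U].
Proof.
move=> hU; have Ui := eu_inj hU; case: (hU) => UD UZ Uip Us.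
have ex y : exists x, U x == y by have [x <-] := Us y; exists x.
pose V y := xchoose (ex y).
have VK : cancel V U by move=> y; apply/eqP/(xchooseP (ex y)).
have UK : cancel U V by move=> x; apply: Ui; rewrite VK.
exists V; split=> //; split=> [x y|a x|x y|y].
- by apply: Ui; rewrite UD !VK.
- by apply: Ui; rewrite UZ !VK conj_ifK.
- by rewrite -[LHS](conj_ifK s) -Uip !VK.
- by exists (U y).
Qed.

(* The matrix of the linear operator [U A U^-1], whether [U] is linear or antilinear. *)
Definition euconj U A : 'M[C]_d :=
  \sum_l U (A *m delta_mx l 0) *m (U (delta_mx l 0))^t*.

Lemma euconjE s U A x : eu s U -> euconj U A *m U x = U (A *m x).
Proof.
move=> hU; case: (hU) => UD UZ Uip Us.
rewrite {2}[x]delta_decomp mulmx_sumr (eu_sum _ _ _ hU) mulmx_suml.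
apply: eq_bigr => l _; rewrite -mulmxA mulmx_ipC Uip mul_mx_scalar ipC_delta.
by rewrite -scalemxAr UZ.
Qed.

Lemma mulcV_inj A B : (forall x, A *m x = B *m x) -> A = B.
Proof.
move=> h; apply/matrixP=> i j; have := h (delta_mx j 0).
by rewrite -!colE => /matrixP/(_ i 0); rewrite !mxE.
Qed.

(** Surjectivity of [U] makes the intertwining relation determine [B]; the algebraic rules for
    [euconj] all follow from this uniqueness. *)
Lemma euconj_uniq s U A B : eu s U ->
  (forall x, B *m U x = U (A *m x)) -> B = euconj U A.
Proof.
move=> hU h; apply: mulcV_inj => y; case: (hU) => _ _ _ /(_ y)[x <-].
by rewrite h (euconjE _ _ hU).
Qed.

Lemma euconjD s U A B : eu s U -> euconj U (A + B) = euconj U A + euconj U B.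
Proof.
move=> hU; symmetry; apply: euconj_uniq (hU) _ => x; case: (hU) => UD _ _ _.
by rewrite !mulmxDl !(euconjE _ _ hU) UD.
Qed.

Lemma euconjZ s U a A : eu s U -> euconj U (a *: A) = conj_if s a *: euconj U A.
Proof.
move=> hU; symmetry; apply: euconj_uniq (hU) _ => x; case: (hU) => _ UZ _ _.
by rewrite -!scalemxAl !(euconjE _ _ hU) UZ.
Qed.

Lemma euconj1 s U : eu s U -> euconj U 1%:M = 1%:M.
Proof.
by move=> hU; symmetry; apply: euconj_uniq (hU) _ => x; rewrite !mul1mx.
Qed.

Lemma euconjM s U A B : eu s U -> euconj U (A *m B) = euconj U A *m euconj U B.
Proof.
move=> hU; symmetry; apply: euconj_uniq (hU) _ => x.
by rewrite -!mulmxA !(euconjE _ _ hU).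
Qed.

Lemma euconj_comp s t U V A : eu s U -> eu t V ->
  euconj (fun x => U (V x)) A = euconj U (euconj V A).
Proof.
move=> hU hV; symmetry; apply: euconj_uniq (eu_comp hU hV) _ => x.
by rewrite (euconjE _ _ hU) (euconjE _ _ hV).
Qed.

Lemma euconj_sum s U I (r : seq I) (P : pred I) (F : I -> 'M[C]_d) : eu s U ->
  euconj U (\sum_(i <- r | P i) F i) = \sum_(i <- r | P i) euconj U (F i).
Proof.
move=> hU; apply: big_morph => [A B|]; first exact: euconjD hU.
by rewrite -(scale0r 0) (euconjZ _ _ hU) conj_if_real ?scale0r // real0.
Qed.

Lemma euconj_adj s U A : eu s U -> (euconj U A)^t* = euconj U (A^t*).
Proof.
move=> hU; apply: euconj_uniq (hU) _ => x; apply: ipC_inj => z.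
case: (hU) => _ _ Uip /(_ z)[{}z <-].
by rewrite ipC_adj trmxCK (euconjE _ _ hU) !Uip [ipC z _]ipC_adj trmxCK.
Qed.

Lemma euconj_herm s U A : eu s U -> A^t* = A -> (euconj U A)^t* = euconj U A.
Proof. by move=> hU hA; rewrite (euconj_adj _ hU) hA. Qed.

Lemma tr_euconj s U A : eu s U -> \tr (euconj U A) = conj_if s (\tr A).
Proof.
move=> hU; case: (hU) => _ _ Uip _.
rewrite linear_sum conj_if_sum; apply: eq_bigr => i _ /=.
by rewrite mxtrace_outer Uip ipC_delta -colE mxE.
Qed.

Lemma psd_euconj s U A : eu s U -> psd A -> psd (euconj U A).
Proof.
move=> hU [hA pA]; split; first exact: euconj_herm hU hA.
move=> x; case: (hU) => _ _ Uip /(_ x)[{}x <-].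
by rewrite (euconjE _ _ hU) Uip conj_if_real ?ger0_real.
Qed.

Lemma density_euconj s U A : eu s U -> density A -> density (euconj U A).
Proof.
move=> hU /densityP[pA tA]; apply/densityP; split; first exact: psd_euconj hU pA.
by rewrite (tr_euconj _ hU) tA conj_if_real ?real1.
Qed.

(** [W] commutes with every Hermitian matrix. The diagonal projections make each basis vector an
    eigenvector, and the real symmetric swaps of two basis vectors make the eigenvalues equal. *)
Lemma commutant_scalar s W : (2 <= d)%N -> eu s W ->
  (forall A, A^t* = A -> euconj W A = A) ->
  exists2 z : C, `|z| = 1 & forall x, W x = z *: x.
Proof.
move=> d2 hW hc; case: (hW) => WD WZ Wip _.
have comm A x : A^t* = A -> W (A *m x) = A *m W x.
  by move=> hA; rewrite -(euconjE _ _ hW) hc.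
pose e (k : 'I_d) : 'cV[C]_d := delta_mx k 0.
pose z k := W (e k) k 0.
have We k : W (e k) = z k *: e k.
  have hP : (delta_mx k k : 'M[C]_d)^t* = delta_mx k k by rewrite trC_delta.
  have := comm _ (e k) hP; rewrite mul_delta_mx => ->.
  rewrite -(mul_delta_mx (0 : 'I_1)) -mulmxA -rowE.
  have -> : row k (W (e k)) = (z k)%:M by rewrite [LHS]mx11_scalar mxE.
  by rewrite mul_mx_scalar.
have ee k : ipC (e k) (e k) = 1 by rewrite ipC_delta mxE !eqxx.
have ekl k l a b : a *: e k = b *: e l -> k = l -> a = b.
  move=> + kl; rewrite kl => /matrixP/(_ l 0); rewrite !mxE !eqxx !mulr1 //.
have swap k l : (delta_mx k l : 'M[C]_d) *m e l = e k by rewrite mul_delta_mx.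
have swap0 k l m : l != m -> (delta_mx k l : 'M[C]_d) *m e m = 0.
  by move=> h; rewrite mul_delta_mx_0.
have zz k l : k != l -> z k = z l.
  move=> kl.
  have hA : (delta_mx k l + delta_mx l k : 'M[C]_d)^t* = delta_mx k l + delta_mx l k.
    by rewrite trC_add !trC_delta addrC.
  have := comm _ (e l) hA; rewrite mulmxDl swap swap0 // addr0 !We -scalemxAr.
  by rewrite mulmxDl swap swap0 // addr0 => /ekl; apply.
pose k0 : 'I_d := Ordinal (ltnW d2); pose k1 : 'I_d := Ordinal d2.
have z1 : `|z k0| = 1.
  have := Wip (e k0) (e k0); rewrite We ipCZl ipCZr ee mulr1 conj_if_real ?real1 //.
  rewrite mulrC -normCK => /eqP; rewrite -[X in _ == X](expr1n _ 2).
  by rewrite eqrXn2 // => /eqP.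
(* For antilinear [W], commuting with the imaginary Hermitian swap of two basis vectors would give z
   = -z, against |z| = 1. Two distinct basis vectors are needed here. *)
have s0 : s = false.
  case: s WZ {hW Wip} => // WZ; have k01 : k1 != k0 by [].
  pose A : 'M[C]_d := 'i *: delta_mx k0 k1 - 'i *: delta_mx k1 k0.
  have hA : A^t* = A.
    by rewrite trC_sub !trC_scale !trC_delta conjCi !scaleNr opprK addrC.
  have eA : A *m e k1 = 'i *: e k0.
    by rewrite mulmxBl -!scalemxAl swap swap0 // scaler0 subr0.
  have := comm _ (e k1) hA; rewrite eA WZ !We -scalemxAr eA !scalerA => /ekl/(_ erefl) /=.
  rewrite conjCi (zz k1 k0) // mulNr mulrC => /esym/eqP; rewrite -subr_eq0 opprK.
  rewrite -mulr2n mulrn_eq0 /= mulf_eq0 (negbTE (neq0Ci _)) orbF => /eqP z0.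
  by move: z1; rewrite z0 normr0 => /eqP; rewrite eq_sym oner_eq0.
exists (z k0) => // x; rewrite {1 2}[x]delta_decomp (eu_sum _ _ _ hW) scaler_sumr.
apply: eq_bigr => i _; rewrite WZ s0 /= We !scalerA mulrC; congr (_ * _ *: _).
by have [->|/zz] := eqVneq i k0.
Qed.

Lemma euconj_phase s t U V : (2 <= d)%N -> eu s U -> eu t V ->
  (forall A, A^t* = A -> euconj U A = euconj V A) <-> phase_equiv U V.
Proof.
move=> d2 hU hV; split=> [h|[z [z1 hz]] A _]; last first.
  symmetry; apply: euconj_uniq (hU) _ => x.
  by rewrite !hz -scalemxAr (euconjE _ _ hV).
have [V' [hV' VK V'K]] := eu_inv hV.
have hW := eu_comp hV' hU.
have [A hA|z z1 hz] := commutant_scalar d2 hW.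
  rewrite (euconj_comp _ hV' hU) h // -(euconj_comp _ hV' hV).
  symmetry; apply: euconj_uniq (eu_comp hV' hV) _ => x; by rewrite !VK.
(* V^-1 U is the scalar z; moving z out through [V] conjugates it when [V] is antilinear. *)
exists (conj_if t z); rewrite norm_conj_if; split=> // x.
by case: hV => _ VZ _ _; rewrite -VZ -hz V'K.
Qed.

End ExtendedUnitary.

(** * Unital order isomorphisms *)

Definition jordan_star (C : numClosedFieldType) (d : nat)
    (S : 'M[C]_d -> 'M[C]_d) : Prop :=
  (forall A, (S A)^t* = S (A^t*)) /\
  (forall A B, S (A *m B + B *m A) = S A *m S B + S B *m S A).

Section Kadison.
Variables (C : numClosedFieldType) (d : nat) (S : {linear 'M[C]_d -> 'M[C]_d}).
Implicit Types A B P : 'M[C]_d.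
Hypothesis S1 : S 1%:M = 1%:M.
Hypothesis Sadj : forall A, (S A)^t* = S (A^t*).
Hypothesis Spsd : forall A, A^t* = A -> (psd (S A) <-> psd A).
Hypothesis Ssurj : forall B, exists A, S A = B.

Lemma order_iso_inj : injective S.
Proof.
have inj0 A : A^t* = A -> S A = 0 -> A = 0.
  move=> hA SA0.
  have p0 : psd (0 : 'M[C]_d) by have := psdZ (lexx 0) (psd1 C d); rewrite scale0r.
  apply: psd_antisym; apply/Spsd; rewrite ?trC_opp ?hA // ?linearN SA0 ?oppr0 //.
apply: raddf_inj => A SA0; have [H [K [hH hK eA]]] := cartesian_decomp A.
have e1 : S H + 'i *: S K = 0 by rewrite -linearZ -linearD -eA.
(* The adjoint of [e1]; together they separate the two Hermitian parts. *)
have e2 : S H - 'i *: S K = 0.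
  have := congr1 (fun X : 'M[C]_d => X^t*) e1.
  by rewrite /= trC_add trC_scale !Sadj hH hK conjCi scaleNr trmx0 map_mx0.
have SH : S H = 0.
  apply/eqP; have : (S H + 'i *: S K) + (S H - 'i *: S K) = 0 by rewrite e1 e2 addr0.
  rewrite addrACA subrr addr0 -mulr2n -scaler_nat => /eqP.
  by rewrite scaler_eq0 pnatr_eq0.
have SK : S K = 0.
  by move: e1; rewrite SH add0r => /eqP; rewrite scaler_eq0 (negbTE (neq0Ci _)) => /eqP.
by rewrite eA (inj0 H) // (inj0 K) // scaler0 addr0.
Qed.

(** On the kernel of [P] the forms of [B] and [B'] are nonnegative with sum zero, so [psd_ker]
    applies there; [1%:M - P] maps into that kernel. *)
Lemma proj_face P B B' : P^t* = P -> P *m P = P -> psd B -> psd B' ->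
  B + B' = P + P -> B *m (1%:M - P) = 0.
Proof.
move=> hP PP pB pB' e; apply/matrixP=> i j.
set y := (1%:M - P) *m delta_mx j 0 : 'cV[C]_d.
have Py : P *m y = 0 by rewrite mulmxA mulmxBr mulmx1 PP subrr mul0mx.
have : B *m y = 0.
  apply: psd_ker => //; apply/eqP; rewrite eq_le pB.2 andbT.
  have : ipC y (B *m y) + ipC y (B' *m y) = 0.
    by rewrite -ipCDr -mulmxDl e mulmxDl Py addr0 ipCE mulmx0 mxE.
  by move/eqP; rewrite addr_eq0 => /eqP ->; rewrite oppr_le0 pB'.2.
by rewrite /y mulmxA -colE => /matrixP/(_ i 0); rewrite !mxE.
Qed.

(* Projections are the extreme points of the order interval [0, 1], and any
   [A] in this interval is the midpoint of [A^2] and [2A - A^2]. *)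
Lemma order_iso_proj P : P^t* = P -> P *m P = P -> S P *m S P = S P.
Proof.
move=> hP PP; set A := S P.
have pP : psd P by rewrite -PP; apply: psd_sqr.
have hP' : (1%:M - P)^t* = 1%:M - P by rewrite trC_sub trC_1 hP.
have PP' : (1%:M - P) *m (1%:M - P) = 1%:M - P.
  by rewrite mulmxBl mul1mx mulmxBr mulmx1 PP subrr subr0.
have pP' : psd (1%:M - P) by rewrite -PP'; apply: psd_sqr.
have pA : psd A by apply/Spsd.
have hA := pA.1.
have pA' : psd (1%:M - A) by rewrite -S1 -linearB; apply/Spsd.
have hA' := pA'.1.
(* A(1-A) = A(1-A)A + (1-A)A(1-A) exhibits it as a sum of conjugates of positive matrices, so A^2 <=
   A. *)
have pAA : psd (A - A *m A).
  have -> : A - A *m A = A^t* *m (1%:M - A) *m A + (1%:M - A)^t* *m A *m (1%:M - A).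
    rewrite hA hA' !(mulmxBl, mulmxBr, mul1mx, mulmx1) ?mulmxA ?opprB ?addrA.
    by rewrite [RHS](ACl (3 * 6 * (1 * 4) * (2 * 5))%AC) /= subrr addNr !addr0.
  by apply: psdD; apply: psd_conj.
(* Pulling A^2 and 2A - A^2 back through [S] writes [P] as the midpoint of [B] and [B'], both in
   [0, 1]. *)
have [B eB] := Ssurj (A *m A).
have hB : B^t* = B.
  by apply: order_iso_inj; rewrite -Sadj eB trC_mul hA.
have pB : psd B by apply/Spsd => //; rewrite eB; apply: psd_sqr.
pose B' := P + P - B.
have hB'0 : B'^t* = B' by rewrite trC_sub trC_add hP hB.
have SB' : S B' = A + A - A *m A by rewrite linearB linearD /= eB.
have pB' : psd B' by apply/Spsd => //; rewrite SB' -addrA; apply: psdD.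
have qB : psd (1%:M - B).
  apply/Spsd; first by rewrite trC_sub trC_1 hB.
  rewrite linearB /= S1 eB.
  have -> : 1%:M - A *m A = (1%:M - A) + (A - A *m A) by rewrite addrA subrK.
  exact: psdD.
have qB' : psd (1%:M - B').
  apply/Spsd; first by rewrite trC_sub trC_1 hB'0.
  rewrite linearB /= S1 SB'.
  have -> : 1%:M - (A + A - A *m A) = (1%:M - A) *m (1%:M - A).
    by rewrite mulmxBl mul1mx mulmxBr mulmx1 !opprB opprD !addrA addrAC.
  exact: psd_sqr.
have eBB : B + B' = P + P by rewrite addrC subrK.
(* Extremality of [P]: the face lemma gives B = BP, and applied to the complements it gives P = BP.
   Hence B = P and A^2 = A. *)
have /eqP := proj_face hP PP pB pB' eBB.
rewrite mulmxBr mulmx1 subr_eq0 => /eqP e1.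
have e2' : (1%:M - B) + (1%:M - B') = (1%:M - P) + (1%:M - P).
  by rewrite addrACA -opprD eBB opprD addrACA.
have /eqP := proj_face hP' PP' qB qB' e2'.
rewrite subKr mulmxBl mul1mx subr_eq0 -e1 => /eqP e2.
by rewrite -eB -e2.
Qed.

(** [P + Q] is a projection, hence so is its image, and the cross terms give pq + qp = 0.
    Multiplying by p on either side yields pq = qp, so 2pq = 0. *)
Lemma order_iso_orth P Q : P^t* = P -> P *m P = P -> Q^t* = Q -> Q *m Q = Q ->
  P *m Q = 0 -> S P *m S Q = 0.
Proof.
move=> hP PP hQ QQ PQ; have QP : Q *m P = 0 by rewrite -hP -hQ -trC_mul PQ trmx0 map_mx0.
have pp := order_iso_proj hP PP; have qq := order_iso_proj hQ QQ.
have := @order_iso_proj (P + Q).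
rewrite trC_add hP hQ => /(_ erefl); rewrite mulmxDl !mulmxDr PP QQ PQ QP addr0 add0r.
move=> /(_ erefl); rewrite linearD /= mulmxDl !mulmxDr pp qq.
move: (S P) (S Q) pp qq => p q pp qq.
rewrite -addrA => /addrI; rewrite addrA -[RHS]add0r => /addIr e.
have e1 : p *m q + p *m q *m p = 0.
  by have := congr1 (mulmx p) e; rewrite mulmxDr !mulmxA pp mulmx0.
have e2 : p *m q *m p + q *m p = 0.
  by have := congr1 (mulmx^~ p) e; rewrite mulmxDl -!mulmxA pp mul0mx.
have e3 : p *m q = q *m p by apply: (addIr (p *m q *m p)); rewrite e1 addrC e2.
by apply/eqP; move/eqP: e; rewrite -e3 -mulr2n -scaler_nat scaler_eq0 pnatr_eq0.
Qed.

(** The images of the spectral projections of [A] are again orthogonal projections, so both sides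
    are the sum of l_i^2 S(P_i). *)
Lemma order_iso_sqr A : A^t* = A -> S (A *m A) = S A *m S A.
Proof.
move=> hA; have [l [v [_ ov ev eA]]] := herm_spectral hA.
pose P i := v i *m (v i)^t*.
have hP i : (P i)^t* = P i by rewrite trC_mul trmxCK.
have PP i j : P i *m P j = if i == j then P i else 0.
  rewrite mulmxA -[_ *m _ *m v j]mulmxA mulmx_ipC ov.
  have [->|_] := eqVneq i j; first by rewrite mulmx1.
  by rewrite -scalemx1 scale0r mulmx0 mul0mx.
have SPP i j : S (P i) *m S (P j) = if i == j then S (P i) else 0.
  have [<-|ij] := eqVneq i j; first by apply: order_iso_proj; rewrite // PP eqxx.
  by apply: order_iso_orth; rewrite // PP ?eqxx // (negbTE ij).
have -> : A *m A = \sum_i (l i * l i) *: P i.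
  rewrite {2}eA mulmx_sumr; apply: eq_bigr => i _.
  by rewrite -scalemxAr mulmxA ev -scalemxAl scalerA.
have SA : S A = \sum_i l i *: S (P i).
  by rewrite {1}eA linear_sum; apply: eq_bigr => i _; rewrite linearZ.
rewrite linear_sum {1}SA mulmx_suml; apply: eq_bigr => i _.
rewrite linearZ /= SA -scalemxAl mulmx_sumr (bigD1 i) //= big1 ?addr0 => [|j ji].
  by rewrite -scalemxAr SPP eqxx scalerA.
by rewrite -scalemxAr SPP eq_sym (negbTE ji) scaler0.
Qed.

(** Polarising the square gives the Jordan identity on Hermitian pairs; complex linearity in each
    argument gives the rest. *)
Lemma order_iso_jordan : jordan_star S.
Proof.
split=> // A B.
pose jor A B := S (A *m B + B *m A) = S A *m S B + S B *m S A.
have jH X Y : X^t* = X -> Y^t* = Y -> jor X Y.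
  move=> hX hY; have := @order_iso_sqr (X + Y).
  rewrite trC_add hX hY => /(_ erefl).
  rewrite !mulmxDl !mulmxDr !(raddfD S) /= !mulmxDl !mulmxDr.
  rewrite (order_iso_sqr hX) (order_iso_sqr hY).
  by rewrite /jor (raddfD S) /= -!addrA => /addrI; rewrite !addrA => /addIr.
have jC X Y : jor X Y -> jor Y X by rewrite /jor addrC => ->; rewrite addrC.
have jL X1 X2 Y : jor X1 Y -> jor X2 Y -> jor (X1 + 'i *: X2) Y.
  rewrite /jor => h1 h2.
  have -> : (X1 + 'i *: X2) *m Y + Y *m (X1 + 'i *: X2) =
      (X1 *m Y + Y *m X1) + 'i *: (X2 *m Y + Y *m X2).
    by rewrite mulmxDl mulmxDr -scalemxAl -scalemxAr addrACA scalerDr.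
  have SDZ X Z : S (X + 'i *: Z) = S X + 'i *: S Z by rewrite linearD linearZ.
  rewrite !SDZ h1 h2.
  by rewrite mulmxDl mulmxDr -scalemxAl -scalemxAr addrACA scalerDr.
have [H [K [hH hK ->]]] := cartesian_decomp A.
have [H' [K' [hH' hK' ->]]] := cartesian_decomp B.
by apply: (jL); apply: jC; apply: (jL); apply: jH.
Qed.

End Kadison.

(** * Jordan automorphisms of the matrix algebra *)

Section MatrixUnits.
Variables (C : numClosedFieldType) (d : nat) (S : {linear 'M[C]_d -> 'M[C]_d}).
Hypothesis SJ : jordan_star S.
Hypothesis Sdiag : forall k : 'I_d, S (delta_mx k k) = delta_mx k k.

Local Notation D k l := (delta_mx k l : 'M[C]_d).
(** [a] measures the automorphism part and [b] the anti-automorphism (transposing) part of [S] on a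
    matrix unit. *)
Let a (k l : 'I_d) : C := S (D k l) k l.
Let b (k l : 'I_d) : C := S (D k l) l k.

(** The Jordan product with [D p p] multiplies entry (m, n) by the number of indices among m, n
    equal to p. For p = k and p = l the image of [D k l] is fixed, which leaves only the entries (k,
    l) and (l, k). *)
Let SD k l : k != l -> S (D k l) = a k l *: D k l + b k l *: D l k.
Proof.
move=> kl; have lk : l != k by rewrite eq_sym.
pose X := S (D k l).
have E m n p : X m n * ((m == p)%:R + (n == p)%:R) =
   (D p p *m X + X *m D p p) m n.
  rewrite -(mul_delta_mx (0 : 'I_1) p p) mulmxA -colE -mulmxA -rowE.
  rewrite mxE [X in _ = X + _]mxE [X in _ = _ + X]mxE !big_ord1 !mxE !eqxx andbT.
  rewrite mulrDr [X m n * _]mulrC; congr (_ + _).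
    by have [->|] := eqVneq m p; rewrite ?mul0r.
  by have [->|] := eqVneq n p; rewrite ?mulr0.
have Ek m n : X m n * ((m == k)%:R + (n == k)%:R) = X m n.
  rewrite E /X -{1 2}[D k k]Sdiag -SJ.2.
  by rewrite mul_delta_mx mul_delta_mx_0 // addr0.
have El m n : X m n * ((m == l)%:R + (n == l)%:R) = X m n.
  rewrite E /X -{1 2}[D l l]Sdiag -SJ.2.
  by rewrite mul_delta_mx mul_delta_mx_0 // add0r.
apply/matrixP=> m n; rewrite -/X; move: (Ek m n) (El m n).
rewrite !mxE /a /b -/X.
have [->|mk] := eqVneq m k; have [->|nk] := eqVneq n k; rewrite ?(negbTE kl) /=.
- by rewrite !(mulr0, addr0) => _ <-.
- have [->|nl] := eqVneq n l; rewrite /= !(mulr0, mulr1, addr0, add0r) //.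
- by have [->|ml] := eqVneq m l; rewrite /= !(mulr0, mulr1, addr0, add0r) // => _ <-.
- by rewrite andbF !(mulr0, addr0) => <-.
Qed.

Let a_adj k l : a l k = (a k l)^*.
Proof. by rewrite /a -trC_delta -SJ.1 trCE. Qed.

Let b_adj k l : b l k = (b k l)^*.
Proof. by rewrite /b -trC_delta -SJ.1 trCE. Qed.

(** Off the diagonal [D k l] squares to zero, while its image squares to ab(D_kk + D_ll). *)
Lemma unit_ab0 k l : k != l -> a k l * b k l = 0.
Proof.
move=> kl; have := SJ.2 (D k l) (D k l).
rewrite mul_delta_mx_0 1?eq_sym // addr0 linear0 (SD kl).
rewrite !(mulmxDl, mulmxDr) -!scalemxAl -!scalemxAr !mul_delta_mx_cond !eqxx.
rewrite eq_sym (negbTE kl) => /matrixP/(_ k k); rewrite !mxE eqxx (negbTE kl) /= => /eqP.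
rewrite !(mulr0, addr0, add0r, mulr1) -mulr2n eq_sym mulrn_eq0 /= => /eqP //.
Qed.

(** By [a_adj] and [b_adj] this reads |a|^2 + |b|^2 = 1; with [unit_ab0], exactly one of the two
    coefficients vanishes. *)
Let aabb k l : k != l -> a k l * a l k + b k l * b l k = 1.
Proof.
move=> kl; have lk : l != k by rewrite eq_sym.
have := SJ.2 (D k l) (D l k).
rewrite !mul_delta_mx linearD /= !Sdiag (SD kl) (SD lk).
rewrite !(mulmxDl, mulmxDr) -!scalemxAl -!scalemxAr !mul_delta_mx_cond !eqxx.
rewrite (negbTE lk) (negbTE kl) => /matrixP/(_ k k); rewrite !mxE !eqxx (negbTE kl) /=.
by rewrite !(mulr0, addr0, add0r, mulr1) [b l k * _]mulrC => <-.
Qed.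

Let triple k l m : k != l -> l != m -> k != m ->
  a k m = a k l * a l m /\ b k m = b k l * b l m.
Proof.
move=> kl lm km; have := SJ.2 (D k l) (D l m).
rewrite mul_delta_mx mul_delta_mx_0 1?eq_sym // addr0 (SD kl) (SD lm) (SD km).
rewrite !(mulmxDl, mulmxDr) -!scalemxAl -!scalemxAr !mul_delta_mx_cond !eqxx.
rewrite ![l == k]eq_sym ![m == _]eq_sym (negbTE lm) (negbTE kl) (negbTE km) /=.
move=> e; split; [move/matrixP/(_ k m): e|move/matrixP/(_ m k): e];
  rewrite !mxE !eqxx ?[m == k]eq_sym (negbTE km) /=;
  rewrite !(mulr0, addr0, add0r, mulr1) => -> //.
exact: mulrC.
Qed.

Lemma unit_type_const k0 l0 : k0 != l0 -> b k0 l0 = 0 ->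
  forall k l, k != l -> b k l = 0.
Proof.
(* The vanishing of [b] spreads to adjacent pairs: if b_kl = 0 but b_lm did not vanish, then a_lm =
   0, and [triple] would kill both a_km and b_km, against [aabb]. *)
have prop k l m : k != l -> l != m -> b k l = 0 -> b l m = 0.
  move=> kl lm bkl; have [<-|km] := eqVneq k m; first by rewrite b_adj bkl rmorph0.
  have [akm bkm] := triple kl lm km.
  have [//|blm] := eqVneq (b l m) 0.
  have /eqP := unit_ab0 lm; rewrite mulf_eq0 (negbTE blm) orbF => /eqP alm.
  move: (aabb km); rewrite akm bkm alm bkl mulr0 !mul0r addr0 => /eqP.
  by rewrite eq_sym oner_eq0.
move=> kl0 b0 k l kl; have [e|l0k] := eqVneq l0 k.
  by rewrite -e in kl *; apply: prop kl0 kl b0.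
exact: prop l0k kl (prop _ _ _ kl0 l0k b0).
Qed.

(** With [b] identically zero, the coefficients [a], completed by 1 on the diagonal, form a
    unimodular cocycle c_km = c_kl c_lm. Fixing the base index [k0] trivialises it, and its values
    c_{k,k0} are the entries of a diagonal unitary. *)
Lemma diag_form k0 l0 : k0 != l0 -> S (D k0 l0) l0 k0 = 0 ->
  exists2 u : 'M[C]_d, u *m u^t* = 1%:M & forall A, S A = u *m A *m u^t*.
Proof.
move=> kl0 b0; have ball := unit_type_const kl0 b0.
pose c k l := if k == l then 1 else a k l.
have cadj k l : c l k = (c k l)^*.
  by rewrite /c eq_sym; case: eqVneq => _; rewrite ?rmorph1 // a_adj.
have aa k l : k != l -> a k l * a l k = 1.
  by move=> kl; have := aabb kl; rewrite (ball _ _ kl) mul0r addr0.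
have Sc k l : S (D k l) = c k l *: D k l.
  rewrite /c; have [->|kl] := eqVneq k l; first by rewrite Sdiag scale1r.
  by rewrite (SD kl) (ball _ _ kl) scale0r addr0.
have cc k l m : c k m = c k l * c l m.
  rewrite /c; have [->|kl] := eqVneq k l; first by rewrite mul1r.
  have [<-|lm] := eqVneq l m; first by rewrite (negbTE kl) mulr1.
  have [<-|km] := eqVneq k m; first by rewrite aa.
  by case: (triple kl lm km).
pose u : 'M[C]_d := diag_mx (\row_k c k k0).
have ut : u^t* = diag_mx (\row_k c k0 k).
  rewrite tr_diag_mx; apply/matrixP=> i j; rewrite !mxE.
  by case: eqVneq => [->|_]; rewrite ?mulr0n ?rmorph0 // !mulr1n -cadj.
exists u.
  rewrite ut /u mulmx_diag -diag_const_mx; congr diag_mx.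
  by apply/matrixP=> i j; rewrite !mxE -cc /c eqxx.
move=> A; apply/matrixP=> i j.
have -> : S A i j = \sum_k \sum_l A k l * (c k l * ((i == k) && (j == l))%:R).
  rewrite {1}[A]matrix_sum_delta (linear_sum S) summxE; apply: eq_bigr => k _.
  rewrite (linear_sum S) summxE; apply: eq_bigr => l _.
  by rewrite linearZ /= Sc !mxE.
rewrite ut mul_diag_mx mul_mx_diag !mxE (bigD1 i) //= [X in _ + X]big1 ?addr0 => [|k ki].
  rewrite (bigD1 j) //= big1 ?addr0 => [|l lj].
    by rewrite !eqxx mulr1 (cc i k0 j) mulrCA mulrA.
  by rewrite [j == l]eq_sym (negbTE lj) andbF !mulr0.
by rewrite big1 // => l _; rewrite [i == k]eq_sym (negbTE ki) !mulr0.
Qed.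

End MatrixUnits.

(** * Reduction to automorphisms fixing the diagonal matrix units *)

Section JordanForm.
Variables (C : numClosedFieldType) (d : nat).

Lemma jordan_diag_form (S : {linear 'M[C]_d -> 'M[C]_d}) : (2 <= d)%N ->
  jordan_star S -> (forall k, S (delta_mx k k) = delta_mx k k) ->
  exists2 u : 'M[C]_d, u *m u^t* = 1%:M &
    (forall A, S A = u *m A *m u^t*) \/ (forall A, S A = u *m A^T *m u^t*).
Proof.
move=> d2 SJ Sdiag.
pose k0 : 'I_d := Ordinal (ltnW d2); pose l0 : 'I_d := Ordinal d2.
have kl0 : k0 != l0 by [].
have /eqP := unit_ab0 SJ Sdiag kl0; rewrite mulf_eq0 => /orP[] /eqP z.
  (* When [a] vanishes, precomposing with the transpose exchanges the two coefficients: the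
     vanishing a at (k0, l0) becomes the b of [S'] at (l0, k0). *)
  pose S' : {linear 'M[C]_d -> 'M[C]_d} := S \o trmx.
  have SJ' : jordan_star S'.
    split=> [A|A B]; first by rewrite /= SJ.1 map_trmx.
    by rewrite /= -SJ.2 linearD /= !trmx_mul addrC.
  have Sdiag' k : S' (delta_mx k k) = delta_mx k k by rewrite /= trmx_delta.
  have lk0 : l0 != k0 by [].
  have [|u uu hu] := diag_form SJ' Sdiag' lk0; first by rewrite /= trmx_delta.
  by exists u => //; right=> A; rewrite -hu /= trmxK.
by have [u uu hu] := diag_form SJ Sdiag kl0 z; exists u => //; left.
Qed.

Lemma proj_unit_vector (P : 'M[C]_d) : P != 0 -> P *m P = P ->
  exists2 x : 'cV[C]_d, ipC x x = 1 & P *m x = x.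
Proof.
move=> P0 PP; have [j cj] : exists j, col j P != 0.
  apply/existsP; apply: contraNT P0 => /existsPn h; apply/eqP/matrixP=> i j.
  by have /negPn/eqP/matrixP/(_ i 0) := h j; rewrite !mxE.
set y := col j P in cj; have Py : P *m y = y by rewrite /y colE mulmxA PP.
have n0 : ipC y y != 0 by apply: contraNneq cj => /ipC_eq0 ->.
exists ((sqrtC (ipC y y))^-1 *: y); last by rewrite -scalemxAr Py.
rewrite ipCZl ipCZr geC0_conj ?invr_ge0 ?sqrtC_ge0 ?ipC_ge0 // mulrA -invfM -expr2 sqrtCK.
exact: mulVf.
Qed.

(** The images of the diagonal units are nonzero, mutually orthogonal projections. A unit vector
    chosen in the range of each gives an orthonormal basis, and conjugation by the resulting unitary
    [W] reduces to the case of fixed diagonal units. *)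
Lemma jordan_form (S : {linear 'M[C]_d -> 'M[C]_d}) : (2 <= d)%N ->
  injective S -> jordan_star S ->
  exists2 u : 'M[C]_d, u *m u^t* = 1%:M &
    (forall A, S A = u *m A *m u^t*) \/ (forall A, S A = u *m A^T *m u^t*).
Proof.
move=> d2 Si SJ; pose P (k : 'I_d) := S (delta_mx k k).
have dbl (X Y : 'M[C]_d) : X + X = Y + Y -> X = Y.
  move/eqP; rewrite -!mulr2n -!scaler_nat => /eqP; by apply: scalerI; rewrite pnatr_eq0.
have hP k : (P k)^t* = P k by rewrite SJ.1 trC_delta.
have PP k : P k *m P k = P k.
  by apply: dbl; rewrite -SJ.2 linearD /= mul_delta_mx.
have P0 k : P k != 0.
  apply/eqP; rewrite -(linear0 S) => /Si/matrixP/(_ k k)/eqP.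
  by rewrite !mxE !eqxx oner_eq0.
have PO k l : k != l -> P k *m P l = 0.
  move=> kl; have := SJ.2 (delta_mx k k) (delta_mx l l).
  rewrite !mul_delta_mx_0 // 1?eq_sym // addr0 linear0 -/(P k) -/(P l) => /esym e.
  have e1 : P k *m P l + P k *m P l *m P k = 0.
    by have := congr1 (mulmx (P k)) e; rewrite mulmxDr !mulmxA PP mulmx0.
  have e2 : P k *m P l *m P k + P l *m P k = 0.
    by have := congr1 (mulmx^~ (P k)) e; rewrite mulmxDl -!mulmxA PP mul0mx.
  have e3 : P k *m P l = P l *m P k.
    by apply: (addIr (P k *m P l *m P k)); rewrite e1 addrC e2.
  by apply: dbl; rewrite {2}e3 e addr0.
have /fin_all_exists2[phi n1 Pphi] k := proj_unit_vector (P0 k) (PP k).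
have Pphi' k l : P k *m phi l = if k == l then phi l else 0.
  have [->|kl] := eqVneq k l; first exact: Pphi.
  by rewrite -Pphi mulmxA PO // mul0mx.
pose W : 'M[C]_d := \matrix_(i, k) phi k i 0.
have Wcol (A : 'M[C]_d) k l : (W^t* *m A *m W) k l = ipC (phi k) (A *m phi l).
  rewrite -mulmxA mxE; apply: eq_bigr => i _; rewrite !mxE; congr (_ * _).
  by apply: eq_bigr => j _; rewrite !mxE.
have oW : W^t* *m W = 1%:M.
  apply/matrixP=> k l; rewrite -[W^t*]mulmx1 Wcol mul1mx mxE.
  have [->|kl] := eqVneq k l; first by rewrite n1.
  by rewrite -Pphi -hP -ipC_adj Pphi' (negbTE kl) ipCE mulmx0 mxE.
have Wo : W *m W^t* = 1%:M by apply: mulmx1C.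
pose S' : {linear 'M[C]_d -> 'M[C]_d} := mulmxr W \o (mulmx (W^t*) \o S).
have S'E A : S' A = W^t* *m S A *m W by [].
have SJ' : jordan_star S'.
  split=> [A|A B]; rewrite !S'E; first by rewrite !trC_mul trmxCK SJ.1 mulmxA.
  rewrite SJ.2 mulmxDr mulmxDl !mulmxA; congr (_ + _).
    by rewrite -[_ *m W *m W^t*]mulmxA Wo mulmx1.
  by rewrite -[_ *m W *m W^t*]mulmxA Wo mulmx1.
have Sdiag' k : S' (delta_mx k k) = delta_mx k k.
  apply/matrixP=> m n; rewrite S'E Wcol -/(P k) Pphi' mxE.
  have [->|kn] := eqVneq k n; last by rewrite andbF ipCE mulmx0 mxE.
  by rewrite andbT -[phi n]mul1mx -Wcol mulmx1 oW mxE.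
have [u uu hu] := jordan_diag_form d2 SJ' Sdiag'.
have SE A : S A = W *m S' A *m W^t*.
  by rewrite S'E !mulmxA Wo mul1mx -mulmxA Wo mulmx1.
exists (W *m u).
  by rewrite trC_mul mulmxA -[_ *m _ *m u^t*]mulmxA uu mulmx1.
by case: hu => hu; [left|right] => A; rewrite SE hu trC_mul !mulmxA.
Qed.

End JordanForm.

(** * SIC frames of Hilbert qplexes *)

Section Qplexes.
Variables (C : numClosedFieldType) (d : nat).

(** The Born-rule probabilities of [A] under the measurement [E]. *)
Definition frame_map (E : 'I_(d ^ 2) -> 'M[C]_d) (A : 'M[C]_d) : vec C d :=
  \col_i \tr (A *m E i).

(* [d E_i] are the SIC projectors; [E] and [G] are dual bases for the trace form. *)
Record sic_frame (G E : 'I_(d ^ 2) -> 'M[C]_d) : Prop := SicFrame {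
  frame_psd : forall i, psd (E i);
  frame_trE : forall i, \tr (E i) = d%:R^-1;
  frame_GE : forall i, G i = (d%:R * (d%:R + 1)) *: E i - 1%:M;
  frame_sum : forall A, A = \sum_i \tr (A *m E i) *: G i;
  frame_tr : forall A, \sum_i \tr (A *m E i) = \tr A;
  frame_dual : forall i j, \tr (G j *m E i) = (i == j)%:R
}.

Lemma hilbert_qplex_frame (Q : vec C d -> Prop) : (0 < d)%N -> hilbert_qplex Q ->
  exists G E, sic_frame G E /\
    forall u, Q u <-> exists rho, density rho /\ u = frame_map E rho.
Proof.
move=> d0 [[Qsub _] [f [[freal flin] finj fsurj fQ fdot]]].
pose N : C := ((d * (d + 1))%N)%:R.
have d0' : d%:R != 0 :> C by rewrite pnatr_eq0 -lt0n.
have d1' : d%:R + 1 != 0 :> C by rewrite natr1 pnatr_eq0.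
have NE : N = d%:R * (d%:R + 1) by rewrite /N natrM natrD.
have N0 : N != 0 by rewrite NE mulf_neq0.
have f0 : f 0 = 0.
  have h0 : hermitian (0 : 'M[C]_d) by move=> i j; rewrite !mxE rmorph0.
  by have := flin 0 0 0 0 (real0 C) (real0 C) h0 h0; rewrite !scale0r !addr0.
have fsum I (r : seq I) (a : I -> C) (X : I -> 'M[C]_d) :
    (forall i, a i \is Num.real) -> (forall i, (X i)^t* = X i) ->
    f (\sum_(i <- r) a i *: X i) = \sum_(i <- r) a i *: f (X i).
  move=> ra hX; elim: r => [|i r IH]; first by rewrite !big_nil.
  rewrite !big_cons -IH.
  have := flin (a i) 1 (X i) (\sum_(j <- r) a j *: X j) (ra i) (real1 C).
  rewrite !scale1r; apply; apply/hermitianP => //.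
  by rewrite trC_sum; apply: eq_bigr => j _; rewrite trC_scale hX conj_Creal.
have dec A : A^t* = A -> exists (l : 'I_d -> C) (P : 'I_d -> 'M[C]_d),
    [/\ forall i, l i \is Num.real, forall i, density (P i) & A = \sum_i l i *: P i].
  move=> /herm_spectral[l [v [lr ov _ eA]]].
  exists l, (fun i => v i *m (v i)^t*); split=> // i.
  by apply: density_outer; rewrite ov eqxx.
have hd P : density P -> P^t* = P by case=> /hermitianP.
have fd P : density P -> inDelta (f P).
  by move=> dP; apply: (proj1 (Qsub _ _)); apply/fQ; exists P.
(* Both sides are linear and equal 1 on densities, since Q lies in the simplex. *)
have ftr A : A^t* = A -> \sum_i f A i 0 = \tr A.
  move=> /dec[l [P [lr dP ->]]]; rewrite fsum => [|//|i]; last exact: hd.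
  rewrite linear_sum.
  under eq_bigr do rewrite summxE.
  rewrite exchange_big; apply: eq_bigr => j _; rewrite linearZ /=.
  under eq_bigr do rewrite mxE.
  by rewrite -mulr_sumr (fd _ (dP j)).2; case: (dP j) => _ _ ->.
have dotC (u v : vec C d) : dotv u v = dotv v u by apply: eq_bigr => i _; rewrite mulrC.
have dotsum (l : 'I_d -> C) (u : 'I_d -> vec C d) v :
    dotv (\sum_i l i *: u i) v = \sum_i l i * dotv (u i) v.
  rewrite /dotv; under eq_bigr do rewrite summxE mulr_suml.
  rewrite exchange_big; apply: eq_bigr => j _; rewrite mulr_sumr.
  by apply: eq_bigr => i _; rewrite mxE mulrA.
(* The inner product formula is given on densities only; spectral decompositions extend it to
   Hermitian matrices one argument at a time, the constant 1 becoming a product of traces. *)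
have fdot1 P B : density P -> B^t* = B ->
    dotv (f P) (f B) = (\tr (P *m B) + \tr B) / N.
  move=> dP /dec[l [R [lr dR ->]]]; rewrite fsum => [|//|i]; last exact: hd.
  rewrite dotC dotsum mulmx_sumr !linear_sum -big_split /= mulr_suml.
  apply: eq_bigr => i _; rewrite dotC fdot // -scalemxAr !linearZ /= mulrA mulrDr.
  by case: (dR i) => _ _ ->.
have fdot2 A B : A^t* = A -> B^t* = B ->
    dotv (f A) (f B) = (\tr (A *m B) + \tr A * \tr B) / N.
  move=> /dec[l [R [lr dR ->]]] hB; rewrite fsum => [|//|i]; last exact: hd.
  rewrite dotsum mulmx_suml !linear_sum mulr_suml -big_split /= mulr_suml.
  apply: eq_bigr => i _; rewrite fdot1 // -scalemxAl !linearZ /=.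
  by case: (dR i) => _ _ ->; rewrite mulr1 mulrA mulrDr.
(* Pairing f(A) with f(G_i), the i-th standard basis vector, reads off the i-th coordinate. The
   inner product formula then forces f(A)_i = tr(A E_i) with E_i = (G_i + 1)/N. *)
have /fin_all_exists[G hG] j : exists A, hermitian A /\ f A = delta_mx j 0.
  apply: fsurj => i; rewrite mxE; exact: realn.
have hG1 i : (G i)^t* = G i by apply/hermitianP; case: (hG i).
have fG i : f (G i) = delta_mx i 0 by case: (hG i).
have trG i : \tr (G i) = 1.
  rewrite -ftr // fG (bigD1 i) //= big1 ?addr0 ?mxE ?eqxx // => j ji.
  by rewrite mxE (negbTE ji).
pose E i := N^-1 *: (G i + 1%:M).
have hE i : (E i)^t* = E i.
  by rewrite trC_scale trC_add trC_1 hG1 fmorphV rmorph_nat.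
have fE A : A^t* = A -> f A = frame_map E A.
  move=> hA; apply/matrixP=> i j; rewrite ord1 [RHS]mxE.
  have <- : dotv (f A) (f (G i)) = f A i 0.
    rewrite fG /dotv (bigD1 i) //= big1 ?addr0 => [|k ki].
      by rewrite mxE !eqxx mulr1.
    by rewrite mxE (negbTE ki) mulr0.
  rewrite fdot2 // trG mulr1 -scalemxAr linearZ /= mulmxDr mulmx1 linearD /=.
  by rewrite mulrC.
have sumH A : A^t* = A -> A = \sum_i \tr (A *m E i) *: G i.
  move=> hA; apply: finj; first exact/hermitianP.
    apply/hermitianP; rewrite trC_sum; apply: eq_bigr => i _.
    by rewrite trC_scale hG1 conj_Creal // tr_mul_real.
  rewrite fsum => [|i|//]; last exact: tr_mul_real.
  rewrite fE // [LHS]delta_decomp; apply: eq_bigr => i _.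
  by rewrite fG mxE.
have trHK (H K X : 'M[C]_d) :
    \tr ((H + 'i *: K) *m X) = \tr (H *m X) + 'i * \tr (K *m X).
  by rewrite mulmxDl -scalemxAl linearD linearZ.
exists G, E; split; last first.
  move=> u; rewrite fQ; split=> -[rho [drho ->]]; exists rho; split=> //;
  by rewrite fE //; exact: hd.
split.
(* Points of Q have nonnegative coordinates, so E_i pairs nonnegatively with every density. *)
- move=> i; apply: psd_dual => // rho drho.
  by have := (fd _ drho).1 i; rewrite fE ?mxE //; exact: hd.
- by move=> i; rewrite linearZ /= linearD /= trG mxtrace1 NE [1 + _]addrC invfM mulfVK.
- by move=> i; rewrite -NE scalerA mulfV // scale1r addrK.
- move=> A; have [H [K [hH hK ->]]] := cartesian_decomp A.
  rewrite {1}(sumH H) // {1}(sumH K) // scaler_sumr -big_split /=.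
  apply: eq_bigr => i _.
  by rewrite trHK scalerDl scalerA.
- move=> A; have [H [K [hH hK ->]]] := cartesian_decomp A.
  rewrite linearD linearZ /= -(ftr H) // -(ftr K) // mulr_sumr -big_split /=.
  apply: eq_bigr => i _.
  by rewrite trHK !fE // !mxE.
- by move=> i j; have /matrixP/(_ i 0) := fE _ (hG1 j); rewrite fG !mxE andbT => <-.
Qed.

(** Normalisation of [q] makes the constant term of q_r linear in [q], so that it can be absorbed
    into the matrix. *)
Lemma qr_stretched (r : 'M[C]_(d ^ 2)) (q : vec C d) :
  \sum_i q i 0 = 1 -> qr r q = stretched r *m q.
Proof.
move=> q1; apply/matrixP=> i j; rewrite ord1 !mxE.
under [RHS]eq_bigr do rewrite mxE mulrBl.
under [LHS]eq_bigr do rewrite mulrBl.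
rewrite !sumrB -!mulr_sumr q1 mulr1; congr (_ - _).
by apply: eq_bigr => k _; rewrite mulrAC.
Qed.

End Qplexes.

(** * The preservation group *)

Section Heisenberg.
Variables (C : numClosedFieldType) (d : nat).
Variables (G E : 'I_(d ^ 2) -> 'M[C]_d) (M : 'M[C]_(d ^ 2)).

(* [M] acting in the Schroedinger picture is [A |-> \sum_i (M F(A))_i G_i];
   this is its adjoint for the trace form. *)
Definition heisenberg (A : 'M[C]_d) : 'M[C]_d :=
  \sum_j (\sum_i \tr (A *m G i) * M i j) *: E j.

Lemma heisenberg_is_linear : linear heisenberg.
Proof.
move=> a A B; rewrite /heisenberg scaler_sumr -big_split /=; apply: eq_bigr => j _.
rewrite scalerA -scalerDl mulr_sumr -big_split /=; congr (_ *: _).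
apply: eq_bigr => i _ /=.
by rewrite mulmxDl -scalemxAl linearD linearZ /= mulrDl mulrA.
Qed.

HB.instance Definition _ :=
  GRing.isLinear.Build C 'M[C]_d 'M[C]_d *:%R heisenberg heisenberg_is_linear.

End Heisenberg.

Section PreservationGroup.
Variables (C : numClosedFieldType) (d : nat) (G E : 'I_(d ^ 2) -> 'M[C]_d).
Hypothesis d2 : (2 <= d)%N.
Hypothesis GE : sic_frame G E.
Local Notation F := (frame_map E).

Let d0 : d%:R != 0 :> C. Proof. by rewrite pnatr_eq0 -lt0n ltnW. Qed.
Let d1 : d%:R + 1 != 0 :> C. Proof. by rewrite natr1 pnatr_eq0. Qed.

Lemma frame_hermE i : (E i)^t* = E i.
Proof. by case: (frame_psd GE i). Qed.

Lemma frame_hermG i : (G i)^t* = G i.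
Proof.
rewrite (frame_GE GE) trC_sub trC_scale trC_1 frame_hermE.
by rewrite rmorphM rmorphD rmorph1 rmorph_nat.
Qed.

Lemma frame_trG i : \tr (G i) = 1.
Proof.
rewrite (frame_GE GE) linearB linearZ /= (frame_trE GE) mxtrace1.
by rewrite mulrAC mulfV // mul1r addrAC subrr add0r.
Qed.

Lemma frame_inj : injective F.
Proof.
move=> A B /matrixP e; rewrite (frame_sum GE A) (frame_sum GE B).
by apply: eq_bigr => i _; have := e i 0; rewrite !mxE => ->.
Qed.

Lemma frame_map_sum (u : vec C d) : F (\sum_i u i 0 *: G i) = u.
Proof.
apply/matrixP=> i j; rewrite ord1 mxE mulmx_suml linear_sum (bigD1 i) //=.
rewrite big1 ?addr0 => [|k ki]; rewrite -scalemxAl linearZ /= (frame_dual GE).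
  by rewrite eqxx mulr1.
by rewrite eq_sym (negbTE ki) mulr0.
Qed.

Lemma frame_dual_sum A : A = \sum_i \tr (A *m G i) *: E i.
Proof.
apply: tr_inj => X; rewrite {1}[X](frame_sum GE) mulmx_suml mulmx_sumr !linear_sum.
apply: eq_bigr => i _ /=; rewrite -scalemxAl -scalemxAr !linearZ /= mulrC.
by rewrite [\tr (A *m _)]mxtrace_mulC.
Qed.

(** Column j holds the coordinates of U G_j U^-1 in the basis [G]. For antilinear [U] the
    conjugation is only real-linear, so the matrix represents it on Hermitian matrices, whose
    coordinates are real. *)
Definition eu_matrix (U : 'cV[C]_d -> 'cV[C]_d) : 'M[C]_(d ^ 2) :=
  \matrix_(i, j) \tr (euconj U (G j) *m E i).

Lemma eu_matrix_frame s U A : eu s U -> A^t* = A -> eu_matrix U *m F A = F (euconj U A).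
Proof.
move=> hU hA; rewrite {2}[A](frame_sum GE) (euconj_sum _ _ _ hU).
apply/matrixP=> i j; rewrite !mxE mulmx_suml linear_sum; apply: eq_bigr => k _.
rewrite !mxE (euconjZ _ _ hU) conj_if_real; last exact: tr_mul_real (frame_hermE _).
by rewrite -scalemxAl linearZ /= mulrC.
Qed.

Lemma eu_matrix_comp s t U V : eu s U -> eu t V ->
  eu_matrix (fun x => U (V x)) = eu_matrix U *m eu_matrix V.
Proof.
move=> hU hV; apply/matrixP=> i j.
have -> : (eu_matrix U *m eu_matrix V) i j = (eu_matrix U *m F (euconj V (G j))) i 0.
  by rewrite !mxE; apply: eq_bigr => k _; rewrite !mxE.
rewrite (eu_matrix_frame hU) ?(euconj_herm hV) ?frame_hermG // !mxE.
by rewrite (euconj_comp _ hU hV).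
Qed.

Lemma eu_matrix_eq s t U V : eu s U -> eu t V ->
  eu_matrix U = eu_matrix V <-> phase_equiv U V.
Proof.
move=> hU hV; rewrite -(euconj_phase d2 hU hV); split=> [e A hA|e].
  by apply: frame_inj; rewrite -(eu_matrix_frame hU hA) -(eu_matrix_frame hV hA) e.
by apply/matrixP=> i j; rewrite !mxE e // frame_hermG.
Qed.

Lemma sum_cst_d2 : \sum_(k < d ^ 2) (d%:R^-1 : C) = d%:R.
Proof. by rewrite sumr_const card_ord -[LHS]mulr_natr natrX expr2 mulrA mulVf // mul1r. Qed.

Variable Q : vec C d -> Prop.
Hypothesis HQ : forall u, Q u <-> exists rho, density rho /\ u = F rho.

Lemma qplex_sum1 u : Q u -> \sum_i u i 0 = 1.
Proof.
move=> /HQ[rho [[_ _ t1] ->]]; rewrite -t1 -(frame_tr GE).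
by apply: eq_bigr => i _; rewrite mxE.
Qed.

Lemma eu_matrix_inG s U : eu s U -> inG Q (eu_matrix U).
Proof.
move=> hU; pose M := eu_matrix U.
have Mcol j : \sum_i M i j = 1.
  under eq_bigr do rewrite mxE.
  by rewrite (frame_tr GE) (tr_euconj _ hU) frame_trG conj_if_real ?real1.
have Mrow i : \sum_j M i j = 1.
  have h1 : (1%:M : 'M[C]_d)^t* = 1%:M by rewrite trC_1.
  have F1 j : F 1%:M j 0 = d%:R^-1 by rewrite mxE mul1mx (frame_trE GE).
  have /matrixP/(_ i 0) := eu_matrix_frame hU h1.
  rewrite (euconj1 hU) F1 mxE; under eq_bigr do rewrite F1.
  by rewrite -mulr_suml => /(canRL (mulfK (invr_neq0 d0))) ->; rewrite mulfV ?invr_neq0.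
(* By the formula for G_j, this entry is d(d+1) tr(U E_j U^-1 E_i), a trace of a product of positive
   matrices. *)
have Mge i j : 0 <= M i j + d%:R^-1.
  rewrite mxE (frame_GE GE) (euconjD _ _ hU) (euconjZ _ _ hU) -scaleN1r.
  rewrite (euconjZ _ _ hU) (euconj1 hU) mulmxDl -!scalemxAl linearD !linearZ /=.
  have Nge0 : 0 <= d%:R * (d%:R + 1) :> C by rewrite mulr_ge0 ?addr_ge0 ?ler0n.
  rewrite mul1mx (frame_trE GE) (conj_if_real s (ger0_real Nge0)).
  rewrite conj_if_real ?rpredN ?real1 // mulN1r subrK; apply: mulr_ge0 => //.
  by apply: psd_tr_ge0 (frame_psd GE _); apply: psd_euconj hU (frame_psd GE _).
(* The solution of [stretched r = M] with row sums 1; these sums are (1 + d^2/d)/(d+1) because the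
   rows of M sum to 1. *)
pose r : 'M[C]_(d ^ 2) := \matrix_(i, j) ((M i j + d%:R^-1) / (d%:R + 1)).
have rrow i : \sum_k r i k = 1.
  under eq_bigr do rewrite mxE.
  by rewrite -mulr_suml big_split /= Mrow sum_cst_d2 addrC mulfV.
have rM : stretched r = M.
  apply/matrixP=> i j; rewrite mxE rrow mulr1 mxE natrD mulrC divfK // addrK //.
exists r; split=> //; last first.
  move=> u; rewrite HQ; split.
    move=> [rho [drho ->]]; have [V [hV UK VK]] := eu_inv hU.
    exists (F (euconj V rho)).
    have QV : Q (F (euconj V rho)).
      by apply/HQ; exists (euconj V rho); split=> //; apply: density_euconj hV drho.
    split=> //; rewrite qr_stretched ?rM ?qplex_sum1 //.
    have hr : rho^t* = rho by case: drho => /hermitianP.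
    rewrite (eu_matrix_frame hU) ?(euconj_herm hV) // -(euconj_comp _ hU hV).
    congr (F _); apply: euconj_uniq (eu_comp hU hV) _ => x.
    by rewrite !VK.
  move=> [q [Qq ->]]; rewrite qr_stretched ?rM ?qplex_sum1 //.
  case/HQ: Qq => rho [drho ->]; exists (euconj U rho).
  split; first exact: density_euconj hU drho.
  by rewrite (eu_matrix_frame hU) //; case: drho => /hermitianP.
split=> [i j|j]; first by rewrite mxE divr_ge0 // addr_ge0 ?ler0n ?ler01.
under eq_bigr do rewrite mxE.
by rewrite -mulr_suml big_split /= Mcol sum_cst_d2 addrC mulfV.
Qed.

Lemma inG_eu_matrix M : inG Q M -> exists U, EU U /\ eu_matrix U = M.
Proof.
move=> [r [[r0 r1] Qr eM]].
have Mreal i j : M i j \is Num.real.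
  rewrite eM mxE; apply: rpredB; apply: rpredM; rewrite ?rpredV ?realn ?ger0_real //.
  exact: sumr_ge0.
have Mcol j : \sum_i M i j = 1.
  rewrite eM; under eq_bigr do rewrite mxE.
  rewrite sumrB -!mulr_sumr r1 exchange_big /=.
  under eq_bigr do rewrite r1.
  by rewrite mulr_sumr !mulr1 sum_cst_d2 natrD addrAC subrr add0r.
have QM u : Q u <-> exists q, Q q /\ u = M *m q.
  rewrite Qr; split=> -[q [Qq ->]]; exists q; split=> //;
  by rewrite qr_stretched ?qplex_sum1 ?eM.
(* [T] is the Schroedinger action of M, a map of the densities onto themselves; its trace-adjoint
   [S] is the map to which the order-isomorphism results apply. *)
pose T A := \sum_i (M *m F A) i 0 *: G i.
have FT A : F (T A) = M *m F A by apply: frame_map_sum.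
pose S : {linear 'M[C]_d -> 'M[C]_d} := heisenberg G E M.
have TS A B : \tr (T B *m A) = \tr (B *m S A).
  rewrite /= /heisenberg mulmx_sumr linear_sum mulmx_suml linear_sum /=.
  under eq_bigr => i _.
    rewrite -scalemxAl linearZ /= mxE mulr_suml.
    under eq_bigr do rewrite mxE.
    over.
  rewrite exchange_big; apply: eq_bigr => j _ /=.
  rewrite -scalemxAr linearZ /= mulr_suml; apply: eq_bigr => i _.
  by rewrite [\tr (A *m _)]mxtrace_mulC; ring.
have Treal A : A^t* = A -> (T A)^t* = T A.
  move=> hA; rewrite trC_sum; apply: eq_bigr => i _.
  rewrite trC_scale frame_hermG conj_Creal // mxE; apply: rpred_sum => j _.
  by rewrite rpredM // mxE tr_mul_real ?frame_hermE.
have Tdens rho : density rho -> density (T rho).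
  move=> drho; have : Q (M *m F rho).
    by apply/QM; exists (F rho); split=> //; apply/HQ; exists rho.
  by rewrite -FT => /HQ[rho' [drho' /frame_inj ->]].
have Tsurj rho : density rho -> exists2 rho', density rho' & rho = T rho'.
  move=> drho; have /QM[q [/HQ[rho' [drho' ->]]]] : Q (F rho) by apply/HQ; exists rho.
  by rewrite -FT => /frame_inj ->; exists rho'.
have Sadj A : (S A)^t* = S (A^t*).
  rewrite /= /heisenberg trC_sum; apply: eq_bigr => j _.
  rewrite trC_scale frame_hermE rmorph_sum; congr (_ *: _); apply: eq_bigr => i _.
  rewrite rmorphM /= (conj_Creal (Mreal i j)) -tr_trC trC_mul frame_hermG.
  by rewrite mxtrace_mulC.
(* Unitality of [S] is trace preservation of [T], that is, the column sums of M being 1. *)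
have S1 : S 1%:M = 1%:M.
  apply: tr_inj => X; rewrite -TS !mulmx1 linear_sum -[RHS](frame_tr GE) /=.
  under eq_bigr do rewrite linearZ /= frame_trG mulr1 mxE.
  rewrite exchange_big; apply: eq_bigr => j _ /=.
  by rewrite -mulr_suml Mcol mul1r mxE.
have Spsd A : A^t* = A -> (psd (S A) <-> psd A).
  move=> hA; split=> pA.
    apply: psd_dual => // rho /Tsurj[rho' drho' ->]; rewrite TS.
    by apply: psd_tr_ge0 pA; case/densityP: drho'.
  apply: psd_dual => [|rho /Tdens]; first by rewrite Sadj hA.
  by rewrite -TS => /densityP[pT _]; apply: psd_tr_ge0.
have Si := order_iso_inj Sadj Spsd.
(* In coordinates along [E], [S] is right multiplication by M; injectivity of [S] then makes M
   invertible, and this gives surjectivity. *)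
have SE (w : 'rV[C]_(d ^ 2)) : S (\sum_i w 0 i *: E i) = \sum_j (w *m M) 0 j *: E j.
  rewrite /= /heisenberg; apply: eq_bigr => j _; rewrite mxE; congr (_ *: _).
  apply: eq_bigr => i _; congr (_ * _).
  rewrite mulmx_suml linear_sum (bigD1 i) //= big1 ?addr0 => [|k ki];
    rewrite -scalemxAl linearZ /= mxtrace_mulC (frame_dual GE).
    by rewrite eqxx mulr1.
  by rewrite (negbTE ki) mulr0.
have Mu : M \in unitmx.
  rewrite -row_free_unit; apply: inj_row_free => w wM; apply/matrixP=> z i.
  rewrite {z}ord1 mxE.
  have : \sum_i w 0 i *: E i = 0.
    apply: Si; rewrite linear0 SE wM big1 // => j _; by rewrite mxE scale0r.
  move/(congr1 (fun A => \tr (A *m G i))); rewrite mul0mx linear0 => <-.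
  rewrite mulmx_suml linear_sum (bigD1 i) //= big1 ?addr0 => [|k ki];
    rewrite -scalemxAl linearZ /= mxtrace_mulC (frame_dual GE).
    by rewrite eqxx mulr1.
  by rewrite (negbTE ki) mulr0.
have Ssurj B : exists A, S A = B.
  pose w := (\row_j \tr (B *m G j)) *m invmx M.
  exists (\sum_i w 0 i *: E i); rewrite SE mulmxKV // [RHS]frame_dual_sum.
  by apply: eq_bigr => j _; rewrite mxE.
have [u uu hu] := jordan_form d2 Si (order_iso_jordan S1 Sadj Spsd Ssurj).
have uu' : u^t* *m u = 1%:M by apply: mulmx1C.
have [s [U [hU SU]]] : exists s U, eu s U /\ forall A, A^t* = A -> S A = euconj U A.
  case: hu => hu.
    have hU : eu false (mulmx u).
      split=> [x y|a x|x y|y]; rewrite ?mulmxDr ?scalemxAr //.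
        by rewrite ipC_adj mulmxA uu' mul1mx.
      by exists (u^t* *m y); rewrite mulmxA uu mul1mx.
    exists false, (mulmx u); split=> // A hA; apply: euconj_uniq (hU) _ => x.
    by rewrite hu -!mulmxA [u^t* *m _]mulmxA uu' mul1mx.
  (* The transpose of a Hermitian matrix is its entrywise conjugate, so this type is implemented by
     the antiunitary x |-> u conj(x). *)
  pose c (x : 'cV[C]_d) : 'cV[C]_d := map_mx Num.conj x.
  have hU : eu true (fun x => u *m c x).
    split=> [x y|a x|x y|y].
    - by rewrite /c map_mxD mulmxDr.
    - by rewrite /c map_mxZ scalemxAr.
    - rewrite ipC_adj mulmxA uu' mul1mx /= rmorph_sum.
      by apply: eq_bigr => i _; rewrite !mxE rmorphM.
    - exists (c (u^t* *m y)); rewrite /c -map_mx_comp map_mx_id ?mulmxA ?uu ?mul1mx //.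
      exact: conjCK.
  exists true, (fun x => u *m c x); split=> // A hA; apply: euconj_uniq (hU) _ => x.
  rewrite hu -!mulmxA [u^t* *m _]mulmxA uu' mul1mx /c map_mxM; congr (_ *m (_ *m _)).
  by rewrite -{1}hA; apply/matrixP=> i j; rewrite !mxE.
(* [S] is conjugation by [U] on the adjoint side, so M itself corresponds to U^-1: conjugating the
   real trace tr(V G_j V^-1 E_i) by [U] turns it into tr(G_j S(E_i)) = tr(T(G_j) E_i) = M_ij. *)
have [V [hV UK VK]] := eu_inv hU.
exists V; split; first by apply/EUP; exists s.
apply/matrixP=> i j; rewrite mxE.
have hVG := euconj_herm hV (frame_hermG j).
rewrite -[LHS](conj_if_real s) ?tr_mul_real ?frame_hermE //.
rewrite -(tr_euconj _ hU) (euconjM _ _ hU) -(euconj_comp _ hU hV).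
have <- : G j = euconj (fun x => U (V x)) (G j).
  by apply: euconj_uniq (eu_comp hU hV) _ => x; rewrite !VK.
rewrite -SU ?frame_hermE // -TS mxtrace_mulC.
have -> : \tr (E i *m T (G j)) = F (T (G j)) i 0 by rewrite mxE mxtrace_mulC.
rewrite FT mxE (bigD1 j) //= big1 ?addr0 => [|k kj]; rewrite mxE (frame_dual GE).
  by rewrite eqxx mulr1.
by rewrite (negbTE kj) mulr0.
Qed.

End PreservationGroup.

(* G(Q) is isomorphic to PEU(d): there is a homomorphism from EU(d) onto
   G(Q) (with matrix product) whose fibres are exactly the phase classes,
   i.e. it induces a group isomorphism PEU(d) = EU(d)/{e^{i theta}I} ~= G(Q). *)
Theorem mainTheorem18 (C : numClosedFieldType) (d : nat) (hd : (2 <= d)%N)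
  (Q : vec C d -> Prop) (hQ : hilbert_qplex Q) :
  exists Phi : ('cV[C]_d -> 'cV[C]_d) -> 'M[C]_(d ^ 2),
    [/\ forall U, EU U -> inG Q (Phi U),
        forall M, inG Q M -> exists U, EU U /\ Phi U = M,
        forall U V, EU U -> EU V -> Phi (fun x => U (V x)) = Phi U *m Phi V &
        forall U V, EU U -> EU V -> (Phi U = Phi V <-> phase_equiv U V)].
Proof.
have [G [E [GE HQ]]] := hilbert_qplex_frame (ltnW hd) hQ.
exists (eu_matrix G E); split.
- by move=> U /EUP[s hU]; apply: eu_matrix_inG hU.
- by move=> M; apply: inG_eu_matrix.
- by move=> U V /EUP[s hU] /EUP[t hV]; apply: eu_matrix_comp hU hV.
- by move=> U V /EUP[s hU] /EUP[t hV]; apply: eu_matrix_eq hU hV.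
Qed.
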